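(* Let $R$ be an arbitrary ring and let $L$ and $M$ be nonzero uniserial left $R$-modules such that the lattices of submodules of $L$ and of $M$ are both isomorphic to the same sublattice of $\mathbb{Z}\cup\{+\infty, -\infty\}$ with the usual order. Then $L$ is isomorphic to $M$ if and only if there is an $R$-module endomorphism $h$ of $L$ with the following properties: (a) $h$ factors through $M$, i.e. there are $R$-module morphisms $f:L\to M$ and $g:M\to L$ with $h=g\circ f$. (b) $h(x)=x$ for some nonzero $x\in L$.
   Context: Rings are associative with identity, and modules are left modules. A module is uniserial if its lattice of submodules (ordered by inclusion) is a chain. *)

(* Defs.v *)
From HB Require Import structures.
From mathcomp Require Import all_boot all_order all_algebra.
From mathcomp Require Import boolp classical_sets functions constructive_ereal.

Set Implicit Arguments.
Unset Strict Implicit.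
Unset Printing Implicit Defensive.

Import Order.TTheory GRing.Theory.

Local Open Scope classical_set_scope.
Local Open Scope ring_scope.

(* Submodules are arbitrary classical sets; the closure condition is wrapped
   in [`[< _ >]] so that [submodule V] is a subtype of [set V]. *)
Record submodule (R : pzRingType) (V : lmodType R) := Submodule {
  submodule_set :> set V;
  _ : `[< GRing.submod_closed [in submodule_set] >]
}.

HB.instance Definition _ (R : pzRingType) (V : lmodType R) :=
  [isSub for @submodule_set R V].
HB.instance Definition _ (R : pzRingType) (V : lmodType R) :=
  [Choice of submodule V by <:].

Fact submodule_display : Order.disp_t. Proof. exact: Order.Disp tt tt. Qed.

(* The order inherited from [set V], i.e. inclusion. *)
HB.instance Definition _ (R : pzRingType) (V : lmodType R) :=
  [SubChoice_isSubPOrder of submodule V by <: with submodule_display].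

Section SubmoduleLattice.
Variables (R : pzRingType) (V : lmodType R).
Implicit Types A B C : submodule V.

Lemma submodule_closed A : GRing.submod_closed [in (A : set V)].
Proof. by case: A => A /= /asboolP. Qed.

Lemma submodule_leP A B :
  reflect ((A : set V) `<=` (B : set V)) (A <= B)%O.
Proof. exact: asboolP. Qed.

Lemma submodule0 A : (A : set V) 0.
Proof. by have [/set_mem] := submodule_closed A. Qed.

Lemma submoduleZD A a (u v : V) :
  (A : set V) u -> (A : set V) v -> (A : set V) (a *: u + v).
Proof.
have [_ cA] := submodule_closed A.
by move=> Au Av; apply/set_mem/cA; rewrite inE.
Qed.

Lemma submoduleI_subproof A B :
  `[< GRing.submod_closed [in (A : set V) `&` (B : set V)] >].
Proof.
apply/asboolP; split=> [|a u v]; rewrite !inE.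
  by split; apply: submodule0.
by move=> [Au Bu] [Av Bv]; split; apply: submoduleZD.
Qed.

Definition submoduleI A B : submodule V := Submodule (submoduleI_subproof A B).

Lemma submoduleD_subproof A B :
  `[< GRing.submod_closed
        [in [set x + y | x in (A : set V) & y in (B : set V)]] >].
Proof.
apply/asboolP; split=> [|a u v]; rewrite !inE.
  exists 0; first exact: submodule0.
  by exists 0; [exact: submodule0 | rewrite addr0].
move=> [x Ax [y By <-]] [z Az [t Bt <-]].
exists (a *: x + z); first exact: submoduleZD.
exists (a *: y + t); first exact: submoduleZD.
by rewrite scalerDr addrACA.
Qed.

Definition submoduleD A B : submodule V := Submodule (submoduleD_subproof A B).

Lemma le_submoduleI A B C : (A <= submoduleI B C)%O = (A <= B)%O && (A <= C)%O.
Proof.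
apply/submodule_leP/andP => [sA|[/submodule_leP AB /submodule_leP AC]].
  by split; apply/submodule_leP => x /sA [].
by move=> x Ax; split; [apply: AB | apply: AC].
Qed.

Lemma submoduleD_le A B C : (submoduleD A B <= C)%O = (A <= C)%O && (B <= C)%O.
Proof.
apply/submodule_leP/andP => [sAB|[/submodule_leP AC /submodule_leP BC]].
  split; apply/submodule_leP => x Px; apply: sAB.
    by exists x => //; exists 0; [exact: submodule0 | rewrite addr0].
  by exists 0; [exact: submodule0 | exists x; rewrite ?add0r].
move=> _ [x Ax [y By <-]]; rewrite -[x]scale1r.
by apply: submoduleZD; [apply: AC | apply: BC].
Qed.

HB.instance Definition _ :=
  Order.POrder_MeetJoin_isLattice.Build submodule_display (submodule V)
    le_submoduleI submoduleD_le.

End SubmoduleLattice.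

Definition uniserial (R : pzRingType) (V : lmodType R) : Prop :=
  total (<=%O : rel (submodule V)).

Definition nonzero_module (R : pzRingType) (V : lmodType R) : Prop :=
  exists x : V, x != 0.

Definition sublattice d (T : latticeType d) (S : set T) : Prop :=
  Order.ClosedPredicates.meet_closed [in S] /\ Order.ClosedPredicates.join_closed [in S].

(* The isomorphism takes its values in the ambient lattice [T'], which spares
   building a lattice structure on the subtype of elements of [S]. *)
Definition lattice_iso_onto d (T : latticeType d) d' (T' : latticeType d')
    (S : set T') : Prop :=
  exists phi : {lmorphism T -> T'}, set_bij [set: T] S phi.

Definition module_iso (R : pzRingType) (U V : lmodType R) : Prop :=
  exists f : {linear U -> V}, bijective f.

(* Main.v *)
Require Import Defs.
From HB Require Import structures.
From mathcomp Require Import all_boot all_order all_algebra.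
From mathcomp Require Import boolp classical_sets functions constructive_ereal.
From mathcomp Require Import zify.

(** If [h = g \o f] fixes [x != 0], then [ker h] meets [R x] trivially and
    [ker g] meets [R (f x)] trivially, so uniseriality makes [f], [g] and [h]
    injective.  If [h] were not onto, the images [h^n(L)] would form an infinite
    strictly decreasing chain of submodules, all containing [R x], which lies
    strictly above [0].  In a subset of [\bar int] the chain is finite-valued
    from its second term on, and so is its lower bound [R x], a contradiction.
    So [h] is onto, and since [g] is injective [f] is onto as well. *)

Set Implicit Arguments.
Unset Strict Implicit.
Unset Printing Implicit Defensive.

Import Order.TTheory GRing.Theory.

Local Open Scope classical_set_scope.
Local Open Scope ring_scope.

Section CyclicSubmodule.
Variables (R : pzRingType) (V : lmodType R).

Lemma submodule_full_subproof : `[< GRing.submod_closed [in [set: V]] >].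
Proof. by apply/asboolP; split=> [|a u v _ _]; rewrite inE. Qed.

Definition submodule_full : submodule V := Submodule submodule_full_subproof.

Lemma submodule_cyclic_subproof (x : V) :
  `[< GRing.submod_closed [in range (fun r : R => r *: x)] >].
Proof.
apply/asboolP; split=> [|a u v]; rewrite !inE.
  by exists 0; rewrite ?scale0r.
by move=> [r _ <-] [s _ <-]; exists (a * r + s); rewrite // scalerDl scalerA.
Qed.

Definition submodule_cyclic (x : V) : submodule V :=
  Submodule (submodule_cyclic_subproof x).

Lemma submodule_cyclic_le (x : V) (A : submodule V) :
  (A : set V) x -> (submodule_cyclic x <= A)%O.
Proof.
move=> Ax; apply/submodule_leP => _ [r _ <-]; rewrite -[_ *: _]addr0.
by apply: submoduleZD => //; exact: submodule0.
Qed.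

Lemma mem_submodule_cyclic (x : V) : (submodule_cyclic x : set V) x.
Proof. by exists 1; rewrite ?scale1r. Qed.

(** [submodule_cyclic 0] stands for the zero submodule. *)
Lemma submodule_cyclic0_lt (x : V) :
  x != 0 -> (submodule_cyclic 0 < submodule_cyclic x)%O.
Proof.
move=> /eqP x0; rewrite lt_leAnge submodule_cyclic_le; last exact: submodule0.
apply/negP => /submodule_leP/(_ _ (mem_submodule_cyclic x)) [r _].
by rewrite scaler0 => /esym.
Qed.

End CyclicSubmodule.

Section KernelImage.
Variables (R : pzRingType) (U V : lmodType R).

Lemma submodule_ker_subproof (f : {linear U -> V}) :
  `[< GRing.submod_closed [in f @^-1` [set 0]] >].
Proof.
apply/asboolP; split=> [|a u v]; rewrite !inE /=; first exact: linear0.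
by move=> fu fv; rewrite linearP fu fv scaler0 addr0.
Qed.

Definition submodule_ker (f : {linear U -> V}) : submodule U :=
  Submodule (submodule_ker_subproof f).

Lemma submodule_image_subproof (f : {linear U -> V}) (A : submodule U) :
  `[< GRing.submod_closed [in f @` (A : set U)] >].
Proof.
apply/asboolP; split=> [|a u v]; rewrite !inE.
  by exists 0; [exact: submodule0 | exact: linear0].
move=> [y Ay <-] [z Az <-].
by exists (a *: y + z); [exact: submoduleZD | rewrite linearP].
Qed.

Definition submodule_image (f : {linear U -> V}) (A : submodule U) :
  submodule V := Submodule (submodule_image_subproof f A).

Lemma submodule_image_lt (f : {linear U -> V}) (A B : submodule U) :
  injective f -> (A < B)%O -> (submodule_image f A < submodule_image f B)%O.
Proof.
move=> inj_f; rewrite !lt_leAnge => /andP[/submodule_leP AB /submodule_leP BA].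
apply/andP; split; first by apply/submodule_leP; exact: image_subset.
apply/submodule_leP => fBA; apply: BA => y By.
by have [|z Az /inj_f <-] := fBA (f y); first by exists y.
Qed.

(** The kernel is comparable with [R x]. If it lies inside, each of its elements is some [r *: x]
    killed by [f], hence zero; if it contains [R x], then [f x = 0], which forces [x = 0]. *)
Lemma uniserial_injective (f : {linear U -> V}) (x : U) :
  uniserial U -> x != 0 -> (forall r : R, f (r *: x) = 0 -> r *: x = 0) ->
  injective f.
Proof.
move=> uniU /eqP x0 kx y z fyz; apply/subr0_eq.
have kyz : (submodule_ker f : set U) (y - z) by rewrite /= linearB fyz subrr.
have /orP[/submodule_leP kerx|/submodule_leP xker] :=
    uniU (submodule_ker f) (submodule_cyclic x).
  by have [r _ yz] := kerx _ kyz; rewrite -yz kx // yz.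
case: x0; rewrite -[x]scale1r; apply: kx; rewrite scale1r.
exact: (xker _ (mem_submodule_cyclic x)).
Qed.

End KernelImage.

Lemma lmorphism_lt d (T : latticeType d) d' (T' : latticeType d')
    (phi : {lmorphism T -> T'}) (x y : T) :
  injective phi -> (x < y)%O -> (phi x < phi y)%O.
Proof.
move=> inj_phi; rewrite !lt_def (inj_eq inj_phi) => /andP[-> xy] /=.
exact: omorph_le.
Qed.

(** The bound [b] is finite: [a < b] excludes [-oo], and [b <= u 1 < u 0] excludes [+oo]. Since
    [u 0] itself may be [+oo], the descent is counted from [u 1], each step losing at least 1. *)
Lemma ereal_int_no_decreasing (u : nat -> \bar int) (a b : \bar int) :
  (a < b)%O -> (forall n, (b <= u n)%O) -> (forall n, (u n.+1 < u n)%O) ->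
  False.
Proof.
move=> ab bu udec.
have [w bw] : exists w : int, b = w%:E.
  case: b ab bu => [w _ _||].
  - by exists w.
  - by move=> _ /(_ 1%N) b1; have := le_lt_trans b1 (udec 0%N); rewrite ltNge leey.
  - by rewrite ltNge leNye.
have ufin n : exists2 z : int, u n.+1 = z%:E & (w <= z)%R.
  have := bu n.+1; have := udec n; rewrite bw.
  case: (u n.+1) => [z _|unoo|_].
  - by rewrite lee_fin; exists z.
  - by move: unoo; rewrite ltNge leey.
  - by rewrite leNgt ltNyr.
have [z0 u1 _] := ufin 0%N.
have bound n : exists2 z : int, u n.+1 = z%:E & (z + n%:Z <= z0)%R.
  elim: n => [|n [z uz le_z]]; first by exists z0; rewrite ?addr0.
  have [z' uz' _] := ufin n.+1; exists z' => //.
  have := udec n.+1; rewrite uz uz' lte_fin; lia.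
(* After this many steps the value is at most [z0 - |z0 - w| - 1], which is below [w]. *)
have [z uz le_z] := bound `|z0 - w|.+1%N.
have [z' uz' le_w] := ufin `|z0 - w|.+1%N.
by move: uz'; rewrite uz => -[zz']; lia.
Qed.

Lemma injective_endo_fix_surj (R : pzRingType) (L : lmodType R)
    (S : set (\bar int)) (h : {linear L -> L}) (x : L) :
  lattice_iso_onto (submodule L) S -> injective h -> x != 0 -> h x = x ->
  forall y, exists z, h z = y.
Proof.
move=> [phi [_ /in2TT inj_phi _]] inj_h x0 hx y; apply: contrapT => y_nim.
pose N n := iter n (submodule_image h) (submodule_full L).
have xN n : (N n : set L) x.
  (* As [h x = x], the point [x] is its own preimage at every stage. *)
  by elim: n => // n IHn; exists x.
apply: (@ereal_int_no_decreasing (phi \o N) (phi (submodule_cyclic 0))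
          (phi (submodule_cyclic x))) => [|n|n] /=.
- by apply: lmorphism_lt => //; exact: submodule_cyclic0_lt.
- by apply: omorph_le; exact: submodule_cyclic_le.
(* Injectivity of [h] carries strictness from one stage to the next; at the first stage, [y]
   witnesses that [h(L)] is proper. *)
apply: lmorphism_lt => //; elim: n => [|n]; last exact: submodule_image_lt.
rewrite lt_leAnge; apply/andP; split; apply/submodule_leP => //.
by move=> /(_ y I) [z _ hz]; apply: y_nim; exists z.
Qed.

Theorem theorem2p11 (R : pzRingType) (L M : lmodType R)
    (nzL : nonzero_module L) (nzM : nonzero_module M)
    (uniL : uniserial L) (uniM : uniserial M)
    (S : set (\bar int)) (subS : sublattice S)
    (isoL : lattice_iso_onto (submodule L) S)
    (isoM : lattice_iso_onto (submodule M) S) :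
  module_iso L M <->
  exists h : {linear L -> L},
    (exists (f : {linear L -> M}) (g : {linear M -> L}), h =1 g \o f) /\
    (exists x : L, x != 0 /\ h x = x).
Proof.
split=> [[f [g fK gK]]|[h [[f [g hgf]] [x [x0 hx]]]]].
  (* [g] is given only as a function; being inverse to a linear map, it is linear, and the identity
     factors as [g' \o f]. *)
  pose g' : {linear M -> L} :=
    HB.pack g (GRing.isLinear.Build R M L _ g (can2_linear fK gK)).
  exists idfun; split; first by exists f, g' => y /=; rewrite fK.
  by have [x x0] := nzL; exists x.
have gfx : g (f x) = x by rewrite -[RHS]hx hgf.
have fx0 : f x != 0.
  by apply: contra_neq x0 => fx; rewrite -gfx fx linear0.
have inj_h : injective h.
  by apply: (uniserial_injective uniL x0) => r; rewrite linearZ hx.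
(* [g (r *: f x) = r *: x]; if this vanishes, so does [f (r *: x) = r *: f x]. *)
have inj_g : injective g.
  apply: (uniserial_injective uniM fx0) => r; rewrite linearZ /= gfx => rx.
  by rewrite -linearZ rx linear0.
have surj_h := injective_endo_fix_surj isoL inj_h x0 hx.
exists f; rewrite -setTT_bijective; split => // [y z _ _ fyz|m _].
  by apply: inj_h; rewrite !hgf /= fyz.
(* A preimage [z] of [g m] under [h] satisfies [g (f z) = g m], and [g] cancels. *)
by have [z hz] := surj_h (g m); exists z => //; apply: inj_g; rewrite -hz hgf.
Qed.
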